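(* Let $r>0$ be an integer and $p>r+1$ a prime. Then $$H(\{1\}^{r-1},-1;p-1)\equiv (-1)^{r-1}\sum_{k=1}^{p-1}\frac{2^k}{k^r}\pmod{p},$$ where $H(\{1\}^{r-1},-1;p-1)=\sum_{0<k_1<\cdots<k_r<p}\frac{(-1)^{k_r}}{k_1k_2\cdots k_r}$.
   Context: $\{1\}^{r-1}$ denotes the list $1,1,\dots,1$ of $r-1$ ones; in general $H(a_1,\dots,a_r;n)=\sum_{1\le k_1<\cdots<k_r\le n}\prod_{i}\operatorname{sign}(a_i)^{k_i}/k_i^{|a_i|}$. For rationals with denominators prime to $p$, $x\equiv y\pmod p$ means $(x-y)/p$ has denominator prime to $p$. *)

(* Defs.v *)
From HB Require Import structures.
From mathcomp Require Import all_boot all_order all_algebra.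
Set Implicit Arguments.
Unset Strict Implicit.
Unset Printing Implicit Defensive.
Import Order.TTheory GRing.Theory Num.Theory.
Local Open Scope ring_scope.

(* The multi-indices 1 <= k_0 < ... < k_(r-1) <= n. *)
Definition mhs_index (r n : nat) (k : {ffun 'I_r -> 'I_n.+1}) : bool :=
  [forall i, (0 < k i)%N] &&
  [forall i : 'I_r, forall j : 'I_r, (i < j)%N ==> (k i < k j)%N].

Definition mhs (a : seq int) (n : nat) : rat :=
  \sum_(k : {ffun 'I_(size a) -> 'I_n.+1} | mhs_index k)
    \prod_(i < size a) ((Num.sg a`_i)%:~R ^+ k i / (k i)%:R ^+ absz a`_i).

Definition p_integral (p : nat) (x : rat) : bool := coprime p `|denq x|%N.

(* The congruence is a relation between p-integral rationals, so the
   p-integrality of both sides is part of it. *)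
Definition rat_eqmod (p : nat) (x y : rat) : bool :=
  [&& p_integral p x, p_integral p y & p_integral p ((x - y) / p%:R)].

(* The explicit form of H({1}^s, -1; n). *)
Lemma mhs_ones_m1E (s n : nat) :
  mhs (rcons (nseq s 1) (-1)) n =
  \sum_(k : {ffun 'I_s.+1 -> 'I_n.+1} | mhs_index k)
    (-1) ^+ k ord_max / \prod_(i < s.+1) (k i)%:R.
Proof.
rewrite /mhs; set a := rcons _ _.
have sz : size a = s.+1 by rewrite size_rcons size_nseq.
have gen m (e : m = s.+1) :
  \sum_(k : {ffun 'I_m -> 'I_n.+1} | mhs_index k)
    \prod_(i < m) ((Num.sg a`_i)%:~R ^+ k i / (k i)%:R ^+ absz a`_i) =
  \sum_(k : {ffun 'I_s.+1 -> 'I_n.+1} | mhs_index k)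
    (-1) ^+ k ord_max / \prod_(i < s.+1) (k i)%:R :> rat.
  subst m; apply: eq_bigr => k _.
  rewrite big_split /= -prodfV; congr (_ * _).
    rewrite big_ord_recr /= big1 ?mul1r => [|i _].
      by rewrite /a nth_rcons size_nseq ltnn eqxx.
    by rewrite /a nth_rcons size_nseq ltn_ord nth_nseq ltn_ord expr1n.
  apply: eq_bigr => i _; rewrite /a nth_rcons size_nseq nth_nseq.
  have := ltn_ord i; rewrite ltnS leq_eqVlt => /predU1P[->|->//].
  by rewrite ltnn eqxx.
exact: gen.
Qed.

(* Main.v *)
Require Import Defs.
From HB Require Import structures.
From mathcomp Require Import all_boot all_order all_algebra.
From mathcomp Require Import ring.
Set Implicit Arguments.
Unset Strict Implicit.
Unset Printing Implicit Defensive.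
Import Order.TTheory GRing.Theory Num.Theory.
Local Open Scope ring_scope.

(* Over a field of characteristic p put
     P_r = sum_(0 < k_1 < ... < k_r < p) X^(k_r) / (k_1 ... k_r),
     Q_r = sum_(0 < k < p) X^k / k^r.
   Both sides of the congruence are values at -1 in the polynomial identity
   P_r(X) = (-1)^(r-1) Q_r(1 - X), which is proved by induction on r.  We have
   X Q_(r+1)' = Q_r, and (1 - X) P_(r+1)' = P_r because the elementary symmetric
   function e_r(1, 1/2, ..., 1/(p-1)) vanishes for 0 < r < p - 1; so the
   derivatives of the two sides agree by induction.  As the degrees are below p,
   the sides then differ by a constant, and both vanish at X = 1.  For r = 1 the
   derivatives agree because (1 - X)^p = 1 - X^p. *)

(** * Reduction of rationals to a field of characteristic p *)

Section Reduction.

Variables (F : fieldType) (p : nat).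
Hypothesis pcharF : p \in [pchar F].

(** Reduction modulo p is encoded as a relation: a fraction, not necessarily in lowest terms, is
    read both in [rat] and in [F]. Sums and products are then handled by operating on numerators and
    denominators. *)
Definition reduces_to (x : rat) (y : F) : Prop :=
  exists n d : int,
    [/\ d%:~R != 0 :> F, x = n%:~R / d%:~R & y = n%:~R / d%:~R].

Lemma intr_neq0_rat (d : int) : d%:~R != 0 :> F -> d%:~R != 0 :> rat.
Proof. by apply: contraNneq => /eqP; rewrite intr_eq0 => /eqP ->. Qed.

Lemma reduces_to_int (n : int) : reduces_to n%:~R n%:~R.
Proof. by exists n, 1; rewrite oner_neq0 !divr1. Qed.

Lemma reduces_toD x y x' y' :
  reduces_to x y -> reduces_to x' y' -> reduces_to (x + x') (y + y').
Proof.
move=> [n [d [d0 -> ->]]] [n' [d' [d0' -> ->]]].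
exists (n * d' + n' * d), (d * d'); rewrite !(intrD, intrM) mulf_neq0 //.
by split=> //; rewrite addf_div ?intr_neq0_rat.
Qed.

Lemma reduces_toM x y x' y' :
  reduces_to x y -> reduces_to x' y' -> reduces_to (x * x') (y * y').
Proof.
move=> [n [d [d0 -> ->]]] [n' [d' [d0' -> ->]]].
exists (n * n'), (d * d'); rewrite !intrM mulf_neq0 //.
by rewrite !mulf_div.
Qed.

Lemma reduces_toX x y k : reduces_to x y -> reduces_to (x ^+ k) (y ^+ k).
Proof.
move=> xy; elim: k => [|k IHk]; first exact: (reduces_to_int 1).
by rewrite !exprS; apply: reduces_toM.
Qed.

Lemma reduces_to_natV k : (0 < k < p)%N -> reduces_to k%:R^-1 k%:R^-1.
Proof.
case/andP=> k0 kp; exists 1, k%:Z; rewrite !mul1r; split=> //.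
by rewrite -pmulrn -(dvdn_pcharf pcharF) gtnNdvd.
Qed.

Lemma reduces_to_sum (I : Type) (s : seq I) (P : pred I) f g :
  (forall i, P i -> reduces_to (f i) (g i)) ->
  reduces_to (\sum_(i <- s | P i) f i) (\sum_(i <- s | P i) g i).
Proof.
move=> fg; apply: (big_ind2 reduces_to) => //; first exact: (reduces_to_int 0).
by move=> *; apply: reduces_toD.
Qed.

Lemma reduces_to_prod (I : Type) (s : seq I) (P : pred I) f g :
  (forall i, P i -> reduces_to (f i) (g i)) ->
  reduces_to (\prod_(i <- s | P i) f i) (\prod_(i <- s | P i) g i).
Proof.
move=> fg; apply: (big_ind2 reduces_to) => //; first exact: (reduces_to_int 1).
by move=> *; apply: reduces_toM.
Qed.

(** The reduced denominator divides [d], and [d] is prime to p because it is nonzero in [F]. *)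
Lemma p_integral_frac (n d : int) :
  d%:~R != 0 :> F -> p_integral p (n%:~R / d%:~R).
Proof.
have pr_p := pcharf_prime pcharF.
rewrite -(dvdz_pcharf pcharF) dvdzE /p_integral prime_coprime //.
case: divqP => [|k x k0] /=; first by rewrite dvdn0.
by rewrite abszM; apply: contra => /dvdn_mull.
Qed.

(** Cross-multiplying the two expressions of [y] shows that p divides n d' - n' d. With quotient m,
    the difference divided by p is m / (d d'), whose denominator is still nonzero in [F]. *)
Lemma rat_eqmod_reduces x x' y :
  reduces_to x y -> reduces_to x' y -> rat_eqmod p x x'.
Proof.
move=> [n [d [d0 -> ->]]] [n' [d' [d0' -> /eqP]]].
rewrite eqr_div // -!intrM -subr_eq0 -intrB -(dvdz_pcharf pcharF).
case/dvdzP=> m eq_m; apply/and3P; split; try exact: p_integral_frac.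
have -> : (n%:~R / d%:~R - n'%:~R / d'%:~R) / p%:R =
    m%:~R / (d * d')%:~R :> rat.
  have p0 : p%:R != 0 :> rat.
    by rewrite pnatr_eq0 -lt0n prime_gt0 ?(pcharf_prime pcharF).
  have := congr1 (fun z : int => z%:~R : rat) eq_m.
  rewrite /= intrB !intrM -pmulrn => e.
  rewrite -mulNr addf_div ?intr_neq0_rat // mulNr e.
  by field; rewrite p0 !intr_neq0_rat.
by apply: p_integral_frac; rewrite intrM mulf_neq0.
Qed.

End Reduction.

(** * Sums over increasing indices as iterated sums *)

Section IncreasingSums.

Variables (F : fieldType).

(* [esymV s m] is the elementary symmetric function of degree [s] in the
   inverses of [1], ..., [m - 1]; the index [j = 0] contributes [0^-1 = 0]. *)
Fixpoint esymV (s m : nat) : F :=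
  if s is s'.+1 then \sum_(j < m) esymV s' j / j%:R else 1.

Lemma esymVS s m : esymV s.+1 m.+1 = esymV s.+1 m + esymV s m / m%:R.
Proof. by rewrite /= big_ord_recr. Qed.

Lemma esymVS_1 s : esymV s.+1 1 = 0.
Proof. by rewrite /= big_ord1 invr0 mulr0. Qed.

Definition ffun_rcons (T : Type) s (k : {ffun 'I_s -> T}) (j : T) :
    {ffun 'I_s.+1 -> T} :=
  [ffun i => if unlift ord_max i is Some i' then k i' else j].

Lemma ffun_rcons_max (T : Type) s (k : {ffun 'I_s -> T}) j :
  ffun_rcons k j ord_max = j.
Proof. by rewrite ffunE unlift_none. Qed.

Lemma ffun_rcons_lift (T : Type) s (k : {ffun 'I_s -> T}) j i :
  ffun_rcons k j (lift ord_max i) = k i.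
Proof. by rewrite ffunE liftK. Qed.

(** Once the largest index [j] is split off, it becomes the strict upper bound of the others.
    Carrying a bound [m] in the condition thus gives a recursion of the same shape as that of
    [esymV]. *)
Lemma mhs_index_rcons s n (k : {ffun 'I_s -> 'I_n.+1}) j m :
  mhs_index (ffun_rcons k j) && [forall i, ffun_rcons k j i < m]%N =
  [&& 0 < j, j < m, mhs_index k & [forall i, k i < j]]%N.
Proof.
apply/andP/and4P => [[/andP[/forallP k0 /forallP kS] /forallP km]|].
  have := k0 ord_max; have := km ord_max; rewrite ffun_rcons_max => jm j0.
  split=> //.
    apply/andP; split; apply/forallP => i.
      by have := k0 (lift ord_max i); rewrite ffun_rcons_lift.
    apply/forallP => i'.
    have /forallP/(_ (lift ord_max i')) := kS (lift ord_max i).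
    by rewrite !ffun_rcons_lift !lift_max.
  apply/forallP => i; have /forallP/(_ ord_max) := kS (lift ord_max i).
  by rewrite ffun_rcons_lift ffun_rcons_max lift_max /= ltn_ord.
move=> [j0 jm /andP[/forallP k0 /forallP kS] /forallP kj].
split; first (apply/andP; split); apply/forallP => i.
- case: (unliftP ord_max i) => [i'|] ->; last by rewrite ffun_rcons_max.
  by rewrite ffun_rcons_lift.
- apply/forallP => i'.
  case: (unliftP ord_max i) => [i1|] ->; case: (unliftP ord_max i') => [i2|] ->;
    rewrite ?ffun_rcons_lift ?ffun_rcons_max ?lift_max /=.
  + by have /forallP := kS i1; apply.
  + by rewrite kj implybT.
  + by rewrite ltnNge ltnW.
  + by rewrite ltnn.
- case: (unliftP ord_max i) => [i'|] ->; last by rewrite ffun_rcons_max.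
  rewrite ffun_rcons_lift; exact: ltn_trans (kj i') jm.
Qed.

Lemma sum_mhs_index_recr s n m (f g : 'I_n.+1 -> F) :
  \sum_(k : {ffun 'I_s.+1 -> 'I_n.+1} | mhs_index k && [forall i, k i < m]%N)
    \prod_(i < s) f (k (lift ord_max i)) * g (k ord_max) =
  \sum_(j : 'I_n.+1 | (0 < j < m)%N)
    (\sum_(k : {ffun 'I_s -> 'I_n.+1} | mhs_index k && [forall i, k i < j]%N)
      \prod_(i < s) f (k i)) * g j.
Proof.
under [RHS]eq_bigr do rewrite big_distrl.
rewrite pair_big_dep /=.
rewrite (reindex (fun u : 'I_n.+1 * {ffun 'I_s -> 'I_n.+1} =>
  ffun_rcons u.2 u.1)).
  apply: eq_big => [[j k]|[j k] _] /=.
    by rewrite mhs_index_rcons -!andbA.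
  by rewrite ffun_rcons_max; under eq_bigr do rewrite ffun_rcons_lift.
apply: onW_bij.
exists (fun k : {ffun 'I_s.+1 -> 'I_n.+1} =>
  (k ord_max, [ffun i => k (lift ord_max i)])) => [[j k]|k] /=.
  rewrite ffun_rcons_max; congr (_, _).
  by apply/ffunP => i; rewrite ffunE ffun_rcons_lift.
apply/ffunP => i; case: (unliftP ord_max i) => [i'|] ->.
  by rewrite ffun_rcons_lift ffunE.
by rewrite ffun_rcons_max.
Qed.

Lemma sum_ord_pos_widen n m (h : nat -> F) : (m <= n.+1)%N -> h 0%N = 0 ->
  \sum_(j < n.+1 | (0 < j < m)%N) h j = \sum_(j < m) h j.
Proof.
move=> mn h0; rewrite (big_ord_widen _ (fun j => h j) mn).
rewrite big_mkcond [RHS]big_mkcond.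
by apply: eq_bigr => -[[|j] hj] _ //=; rewrite h0 if_same.
Qed.

Lemma esymVE s n m : (m <= n.+1)%N ->
  \sum_(k : {ffun 'I_s -> 'I_n.+1} | mhs_index k && [forall i, k i < m]%N)
    \prod_(i < s) (k i)%:R^-1 = esymV s m.
Proof.
elim: s m => [|s IHs] m mn.
  rewrite (eq_bigl predT) => [|k]; last first.
    by apply/andP; split; [apply/andP; split|]; apply/forallP => -[].
  under eq_bigr do rewrite big_ord0.
  by rewrite sumr_const card_ffun !card_ord expn0.
have widen_lift (i : 'I_s) : widen_ord (leqnSn s) i = lift ord_max i.
  by apply/val_inj/esym/lift_max.
under eq_bigr do rewrite big_ord_recr /=.
under eq_bigr => k _ do under eq_bigr => i _ do rewrite widen_lift.
rewrite (sum_mhs_index_recr _ _ (fun j => j%:R^-1) (fun j => j%:R^-1)) /=.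
rewrite -(@sum_ord_pos_widen _ _ (fun j => esymV s j / j%:R) mn) ?invr0 ?mulr0 //.
apply: eq_bigr => j /andP[_ jm]; rewrite IHs //.
exact: leq_trans (ltnW jm) mn.
Qed.

Lemma sum_mhs_index_ones s n (a : F) :
  \sum_(k : {ffun 'I_s.+1 -> 'I_n.+1} | mhs_index k)
    a ^+ k ord_max / \prod_(i < s.+1) (k i)%:R =
  \sum_(j < n.+1) a ^+ j * (esymV s j / j%:R).
Proof.
transitivity (\sum_(k : {ffun 'I_s.+1 -> 'I_n.+1} |
      mhs_index k && [forall i, k i < n.+1]%N)
    \prod_(i < s) (k (lift ord_max i))%:R^-1 *
    (a ^+ k ord_max / (k ord_max)%:R)).
  (* The bound [n.+1] holds for every index; it is inserted only to match the form of the
     recursion. *)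
  apply: eq_big => [k|k _].
    by rewrite [X in _ && X](_ : _ = true) ?andbT //; apply/forallP.
  rewrite big_ord_recr /= invfM prodfV.
  rewrite (eq_bigr (fun i => (k (lift ord_max i))%:R)) => [|i _]; first by ring.
  by congr (k _)%:R; apply/val_inj/esym/lift_max.
rewrite (sum_mhs_index_recr _ _ (fun j => j%:R^-1) (fun j => a ^+ j / j%:R)) /=.
rewrite -(@sum_ord_pos_widen n n.+1 (fun j => a ^+ j * (esymV s j / j%:R)))
  ?invr0 ?mulr0 //.
apply: eq_bigr => j /andP[_ jm]; rewrite esymVE; first by ring.
exact: ltnW.
Qed.

End IncreasingSums.

(** * Polynomial identities in characteristic p *)

Section CharP.

Variables (F : fieldType) (p : nat).
Hypothesis pcharF : p \in [pchar F].

Let pr_p : prime p := pcharf_prime pcharF.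
Let p_gt0 : (0 < p)%N := prime_gt0 pr_p.

Lemma natr_neq0_lt k : (0 < k < p)%N -> k%:R != 0 :> F.
Proof. by case/andP=> k0 kp; rewrite -(dvdn_pcharf pcharF) gtnNdvd. Qed.

Lemma natr_inj_lt i j : (i < p)%N -> (j < p)%N -> i%:R = j%:R :> F -> i = j.
Proof.
wlog ij : i j / (i <= j)%N => [hw ip jp eij|ip jp /eqP].
  by case/orP: (leq_total i j) => le; [apply: hw | apply/esym/hw].
rewrite eq_sym -subr_eq0 -natrB // -(dvdn_pcharf pcharF) => dv.
apply/eqP; rewrite eqn_leq ij -subn_eq0 /=.
apply: contraLR dv; rewrite -lt0n => d0.
by rewrite gtnNdvd // (leq_ltn_trans (leq_subr _ _)).
Qed.

(** The Frobenius map fixes the image of every integer, so x^p = x for x = -j, and x can be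
    cancelled. *)
Lemma oppr_nat_fermat j : (0 < j < p)%N -> (- j%:R) ^+ p.-1 = 1 :> F.
Proof.
move=> hj; have j0 : - j%:R != 0 :> F by rewrite oppr_eq0 natr_neq0_lt.
apply: (mulfI j0); rewrite -exprS prednK // mulr1.
by rewrite -(pFrobenius_autE pcharF) pFrobenius_autN pFrobenius_aut_nat.
Qed.

(** Generating polynomial of the [esymV s m] for varying [s]. Its factor at [j = 0] is 1, which
    keeps the degree below [m] when [m] is positive. *)
Definition esymV_poly m : {poly F} := \prod_(j < m) (1 + j%:R^-1 *: 'X).

Lemma coef_esymV_poly s m : (esymV_poly m)`_s = esymV F s m.
Proof.
rewrite /esymV_poly; elim: m s => [|m IHm] s.
  by rewrite big_ord0 coef1; case: s => [|s] //=; rewrite big_ord0.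
rewrite big_ord_recr /= mulrDr mulr1 coefD -scalerAr coefZ coefMX IHm.
by case: s => [|s]; rewrite ?mulr0 ?addr0 // IHm esymVS mulrC.
Qed.

Lemma size_esymV_poly m : (size (esymV_poly m.+1) <= m.+1)%N.
Proof.
rewrite /esymV_poly; elim: m => [|m IHm].
  by rewrite big_ord1 invr0 scale0r addr0 size_poly1.
rewrite big_ord_recr /=; apply: leq_trans (size_polyMleq _ _) _.
have : (size (1 + m.+1%:R^-1 *: 'X : {poly F})%R <= 2)%N.
  rewrite (leq_trans (size_polyD _ _)) // geq_max size_poly1 /=.
  by rewrite (leq_trans (size_scale_leq _ _)) // size_polyX.
by move=> /(leq_add IHm); rewrite addn2; case: (_ + _)%N.
Qed.

(* Both sides have degree below [p] and agree at the [p] points [- j%:R]. *)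
Lemma esymV_poly_p : esymV_poly p = 1 - 'X^(p.-1).
Proof.
apply/eqP; rewrite -subr_eq0; apply/eqP.
apply: (roots_geq_poly_eq0 (rs := [seq - j%:R | j <- iota 0 p])).
- apply/allP => x /mapP[j]; rewrite mem_iota add0n /= => jp -> {x}.
  rewrite rootE !hornerE horner_prod subr_eq0; apply/eqP.
  (* At 0 both sides equal 1. At any other [- j%:R] the factor of index [j] kills the product, and
     Fermat's little theorem kills the right-hand side. *)
  case: j jp => [|j] jp.
    rewrite big1 => [|i _]; last by rewrite !hornerE /= oppr0 ?mulr0 addr0.
    rewrite oppr0 expr0n (gtn_eqF (_ : 0 < p.-1)%N) ?subr0 //.
    by rewrite -ltnS prednK // prime_gt1.
  have hj : (0 < j.+1 < p)%N by [].
  rewrite (bigD1 (Ordinal jp)) //= !hornerE /= mulrN mulVf ?natr_neq0_lt //.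
  by rewrite subrr mul0r oppr_nat_fermat // subrr.
- rewrite map_inj_in_uniq ?iota_uniq // => i j; rewrite !mem_iota !add0n /= => ip jp.
  by move/oppr_inj; apply: natr_inj_lt.
- have := size_esymV_poly p.-1; rewrite prednK // => sz.
  rewrite size_map size_iota (leq_trans (size_polyD _ _)) //.
  rewrite geq_max sz size_polyN.
  rewrite (leq_trans (size_polyD _ _)) // geq_max size_polyN size_poly1.
  by rewrite size_polyXn prednK // leqnn p_gt0.
Qed.

Lemma esymV_p_eq0 s : (0 < s < p.-1)%N -> esymV F s p = 0.
Proof.
case/andP=> s0 sp; rewrite -coef_esymV_poly esymV_poly_p.
by rewrite coefB coef1 coefXn (gtn_eqF s0) (ltn_eqF sp) subrr.
Qed.

(* [ones_poly s] is P_(s+1) of the header. *)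
Definition ones_poly s : {poly F} := \poly_(j < p) (esymV F s j / j%:R).

(** This is Q_r of the header for r > 0, where the constant coefficient vanishes because
    [0^-1 = 0]. *)
Definition polylog_poly r : {poly F} := \poly_(j < p) j%:R ^- r.

(** Differentiation multiplies the coefficient of X^(i+1) by i+1, which is invertible in [F] as long
    as i+1 < p. The constant is written as the value at 1, where P_r and Q_r(1 - X) are compared. *)
Lemma deriv_eq0_poly (D : {poly F}) :
  (size D <= p)%N -> D^`() = 0 -> D = (D.[1])%:P.
Proof.
move=> sD D0; suff eD : D = (D`_0)%:P by rewrite {2}eD hornerC.
apply/polyP => -[|i]; rewrite coefC //=.
case: (ltnP i.+1 p) => ip; last by rewrite nth_default // (leq_trans sD).
have /eqP := congr1 (fun q : {poly F} => q`_i) D0.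
rewrite coef_deriv coef0 -mulr_natr mulf_eq0 (negbTE (natr_neq0_lt _)) ?orbF //.
by move/eqP.
Qed.

Lemma XM_deriv_polylog r :
  'X * (polylog_poly r.+2)^`() = polylog_poly r.+1.
Proof.
apply/polyP => i; rewrite coefXM coef_deriv !coef_poly.
case: i => [|i] /=; first by rewrite p_gt0 exprS mul0r invr0.
case: ifP => ip; last by rewrite mul0rn.
have i0 : i.+1%:R != 0 :> F by exact: natr_neq0_lt.
by rewrite -[LHS]mulr_natr exprS invfM mulrAC mulVf // mul1r.
Qed.

(** The derivative of Q_1 is the geometric sum 1 + X + ... + X^(p-2). *)
Lemma deriv_polylog1 : (1 - 'X) * (polylog_poly 1)^`() = 1 - 'X^(p.-1).
Proof.
rewrite -opprB -[RHS]opprB subrX1 mulNr; congr (- (_ * _)).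
have -> : \sum_(i < p.-1) 'X^i = \poly_(i < p.-1) 1 :> {poly F}.
  by rewrite poly_def; apply: eq_bigr => i _; rewrite scale1r.
apply/polyP => i; rewrite coef_deriv !coef_poly.
rewrite ltn_predRL; case: ifP => ip; last by rewrite mul0rn.
by rewrite expr1 -[LHS]mulr_natr mulVf // natr_neq0_lt.
Qed.

Arguments esymV : simpl never.

(** Coefficientwise this is the recursion [esymVS]. The truncation at degree p - 1 is the only
    obstacle, and the vanishing of [esymV F s.+1 p] removes it. *)
Lemma subX_deriv_ones s : (s.+1 < p.-1)%N ->
  (1 - 'X) * (ones_poly s.+1)^`() = ones_poly s.
Proof.
move=> sp; apply/polyP => i.
rewrite mulrBl mul1r coefB coefXM !coef_deriv !coef_poly.
have simp j : (0 < j < p)%N -> (esymV F s.+1 j / j%:R) *+ j = esymV F s.+1 j.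
  by move=> hj; rewrite -mulr_natr divfK // natr_neq0_lt.
have last_eq0 : esymV F s.+1 p = 0 by apply: esymV_p_eq0.
case: i => [|i] /=.
  rewrite subr0 p_gt0 prime_gt1 // invr0 mulr0 simp ?prime_gt1 //.
  exact: esymVS_1.
(* Coefficient of X^(i+1): the generic case, then the case beyond the degree of both sides, then i +
   2 = p. In the last one the derivative has no term of degree p - 1, and the missing value
   [esymV F s.+1 p] is 0. *)
case: (ltngtP i.+2 p) => ip.
- have ip' := ltnW ip; rewrite !simp //.
  by rewrite esymVS addrC addKr.
- by rewrite !mul0rn subr0.
- rewrite mul0rn sub0r simp; last by rewrite -ip ltnS /=.
  by apply/eqP; rewrite eq_sym -addr_eq0 addrC -esymVS ip last_eq0.
Qed.

Lemma size_subX : size (1 - 'X : {poly F}) = 2.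
Proof. by rewrite -size_polyN opprB size_XsubC. Qed.

Lemma deriv_comp_subX (q : {poly F}) :
  (q \Po (1 - 'X))^`() = - (q^`() \Po (1 - 'X)).
Proof. by rewrite deriv_comp derivB derivC derivX sub0r mulrN1. Qed.

Lemma horner_ones_poly_1 s : (ones_poly s).[1] = esymV F s.+1 p.
Proof. by rewrite horner_poly; apply: eq_bigr => j _; rewrite expr1n mulr1. Qed.

Lemma horner_polylog_0 r : (polylog_poly r.+1).[0] = 0.
Proof. by rewrite horner_coef0 coef_poly p_gt0 exprS mul0r invr0. Qed.

Lemma eq_poly_deriv_ones s (q : {poly F}) : (s.+1 < p.-1)%N ->
    (size q <= p)%N -> q.[1] = 0 -> (ones_poly s)^`() = q^`() ->
  ones_poly s = q.
Proof.
move=> sp sq q1 eq_der; apply/eqP; rewrite -subr_eq0; apply/eqP.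
rewrite [LHS]deriv_eq0_poly.
- by rewrite hornerD hornerN q1 subr0 horner_ones_poly_1 esymV_p_eq0.
- by rewrite (leq_trans (size_polyD _ _)) // geq_max size_polyN size_poly sq.
- by rewrite derivB eq_der subrr.
Qed.

Lemma expr_subX_pchar : (1 - 'X : {poly F}) ^+ p = 1 - 'X^p.
Proof.
have pchar_poly : p \in [pchar {poly F}] by rewrite pchar_poly.
rewrite -(pFrobenius_autE pchar_poly) pFrobenius_autB_comm; last exact: mulrC.
by rewrite !pFrobenius_autE expr1n.
Qed.

Lemma ones_polylog s : (s.+1 < p.-1)%N ->
  ones_poly s = (-1) ^+ s *: (polylog_poly s.+1 \Po (1 - 'X)).
Proof.
have X1 : 1 - 'X != 0 :> {poly F} by rewrite -size_poly_gt0 size_subX.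
have X0 : 'X != 0 :> {poly F} by rewrite polyX_eq0.
have szq r c : (size (c *: (polylog_poly r \Po (1 - 'X))) <= p)%N.
  rewrite (leq_trans (size_scale_leq _ _)) //.
  by rewrite size_comp_poly2 ?size_subX ?size_poly.
have q1 r c : (c *: (polylog_poly r.+1 \Po (1 - 'X))).[1] = 0.
  by rewrite hornerZ horner_comp !hornerE subrr horner_polylog_0 mulr0.
elim: s => [|s IHs] sp; apply: eq_poly_deriv_ones => //.
  have -> : ones_poly 0 = polylog_poly 1.
    by apply/polyP => i; rewrite !coef_poly mul1r.
  rewrite expr0 scale1r deriv_comp_subX.
  (* The factor 1 - X clears the derivative of P_1, and X clears that of Q_1(1 - X). Both sides
     become X - X^p, the second one through (1 - X)^p = 1 - X^p. *)
  apply: (mulfI (mulf_neq0 X0 X1)).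
  rewrite -mulrA deriv_polylog1.
  have := congr1 (comp_poly (1 - 'X)) deriv_polylog1.
  rewrite comp_polyM !comp_polyB comp_polyX comp_Xn_poly !comp_polyC.
  rewrite opprB addrC subrK => e.
  rewrite mulrN [X in - (X * _)]mulrC -mulrA e !mulrBr !mulr1 -!exprS prednK //.
  rewrite expr_subX_pchar.
  by ring.
apply: (mulfI X1); rewrite (subX_deriv_ones (ltnW sp)) (IHs (ltnW sp)).
rewrite derivZ deriv_comp_subX -scalerAr mulrN.
(* Reading the factor 1 - X as X composed with 1 - X lets X Q_(s+2)' = Q_(s+1) apply under the
   composition. The sign of the chain rule accounts for the extra factor -1. *)
rewrite -[X in X * (_ \Po _)](comp_polyX (1 - 'X)) -comp_polyM XM_deriv_polylog.
by rewrite exprS mulN1r scaleNr scalerN opprK.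
Qed.

End CharP.

(** * Specialization to the prime field at X = -1 *)

Theorem theorem2p3 (r p : nat) (hr : (0 < r)%N) (hp : prime p)
    (hrp : (r + 1 < p)%N) :
  rat_eqmod p
    (mhs (rcons (nseq (r - 1) 1) (-1)) (p - 1))
    ((-1) ^+ (r - 1) * \sum_(1 <= k < p) 2%:R ^+ k / k%:R ^+ r).
Proof.
case: r hr hrp => [//|s] _; rewrite addn1 subSS subn0 => sp.
have pcharF := pchar_Fp hp.
have p0 := prime_gt0 hp.
have sp' : (s.+1 < p.-1)%N by rewrite -ltnS prednK.
rewrite mhs_ones_m1E.
(* The common reduction of both sides in ['F_p] is P_r(-1), with r = s + 1. *)
apply: (@rat_eqmod_reduces _ _ pcharF _ _ (ones_poly 'F_p p s).[-1]).
  rewrite horner_poly.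
  have -> : \sum_(i < p) esymV 'F_p s i / i%:R * (-1) ^+ i =
    \sum_(i < (p - 1).+1) (-1) ^+ i * (esymV 'F_p s i / i%:R).
    by rewrite subn1 prednK //; apply: eq_bigr => i _; rewrite mulrC.
  rewrite -sum_mhs_index_ones; apply: reduces_to_sum => k /andP[/forallP k0 _].
  apply: reduces_toM; first exact: reduces_toX (reduces_to_int _ (-1)).
  rewrite -!prodfV; apply: reduces_to_prod => i _.
  apply: (reduces_to_natV pcharF).
  by rewrite k0 -[X in (_ < X)%N](prednK p0) -subn1 ltn_ord.
(* Since 1 - (-1) = 2, this turns P_r(-1) into (-1)^s Q_r(2), whose term of index 0 vanishes. *)
rewrite (ones_polylog pcharF sp') hornerZ horner_comp !hornerE opprK.
apply: reduces_toM; first exact: reduces_toX (reduces_to_int _ (-1)).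
rewrite horner_poly -(big_mkord predT (fun i => i%:R ^- s.+1 * (1 + 1) ^+ i)).
rewrite [X in reduces_to _ X]big_ltn // exprS mul0r invr0 mul0r add0r.
rewrite !big_nat; apply: reduces_to_sum => k hk.
rewrite mulrC -!exprVn; apply: reduces_toM; apply: reduces_toX.
  exact: (reduces_to_natV pcharF).
exact: (reduces_to_int _ 2).
Qed.
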